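(* Let $k$ be an arbitrary field, $R=k[x_1,\ldots,x_n]$, and let $F=\{x^{v_1},\ldots,x^{v_q}\}\subset R$ be a finite set of $q$ distinct monomials of the same degree $d\geq 2$, having no non-trivial common factor and such that every variable $x_i$ divides at least one member of $F$. Let $A$ be the log-matrix of $F$, let $\mathcal{LS}(F)$ be the matrix of linear syzygies of $F$, and let $\mathbf{x}_d$ be the set of all monomials of degree $d$ in $R$. If $\mathrm{rank}(A)=n$ and $\mathrm{rank}(\mathcal{LS}(F))=q-1$, then $k[F]\subset k[\mathbf{x}_d]$ is birational.
   Context: For $\alpha=(a_1,\ldots,a_n)\in\mathbb{N}^n$, $x^\alpha=x_1^{a_1}\cdots x_n^{a_n}$. The log-matrix of $F$ is the $n\times q$ integer matrix $A=(v_1,\ldots,v_q)$ whose columns are the exponent vectors; its rank is over $\mathbb{Q}$. Let $e'_1,\ldots,e'_q$ be the canonical basis of $R^q$. $\mathcal{LS}(F)$ is the matrix over $R$ with $q$ rows whose columns are all vectors of the form $x_ie'_j-x_ke'_\ell$ such that $x_ix^{v_j}=x_kx^{v_\ell}$; its rank is taken over the fraction field of $R$. $k[F]$ denotes the $k$-subalgebra of $R$ generated by $F$. An extension $D'\subset D$ of integral domains is birational if $D'$ and $D$ have the same field of fractions. *)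

(* Defs.v *)
From HB Require Import structures.
From mathcomp Require Import all_boot all_order all_algebra.
From mathcomp Require Import mpoly.

Set Implicit Arguments.
Unset Strict Implicit.
Unset Printing Implicit Defensive.

Import GRing.Theory.
Local Open Scope ring_scope.

Definition divides (R : comNzRingType) (a b : R) : Prop := exists c, b = a * c.

(* Subsets of a ring are Prop-valued predicates: membership in a subalgebra or
   in a field of fractions is not given with a decision procedure. *)
Inductive subalg_gen (K : nzRingType) (A : algType K) (S : A -> Prop) :
  A -> Prop :=
| subalg_gen_scalar c : subalg_gen S c%:A
| subalg_gen_mem x of S x : subalg_gen S x
| subalg_gen_add x y of subalg_gen S x & subalg_gen S y : subalg_gen S (x + y)
| subalg_gen_mul x y of subalg_gen S x & subalg_gen S y : subalg_gen S (x * y).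

(* For a subring D of the domain R, Frac(D) is realised inside Frac(R). *)
Definition in_frac (R : idomainType) (D : R -> Prop) (f : {fraction R}) : Prop :=
  exists a b : R, [/\ D a, D b, b != 0 & f = tofrac a / tofrac b].

Definition birational (R : idomainType) (D' D : R -> Prop) : Prop :=
  (forall x, D' x -> D x) /\ (forall f, in_frac D' f <-> in_frac D f).

Section Monomials.

Variables (k : fieldType) (n q : nat).

(* A family of monomials is given by its exponent vectors v_1, ..., v_q. *)
Variable v : 'I_q -> 'X_{1..n}.

Definition monomials (m : {mpoly k[n]}) : Prop := exists j, m = 'X_[v j].

Definition monomials_of_degree (d : nat) (m : {mpoly k[n]}) : Prop :=
  exists w : 'X_{1..n}, mdeg w = d /\ m = 'X_[w].

Definition log_matrix : 'M[int]_(n, q) := \matrix_(i, j) (v j i)%:Z.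

(* The tuple ((i, j), (i', l)) stands for the equality
   x_i x^(v_j) = x_i' x^(v_l). *)
Definition linsyz_index : {set ('I_n * 'I_q) * ('I_n * 'I_q)} :=
  [set s | 'X_(s.1.1) * 'X_[v s.1.2]
           == 'X_(s.2.1) * 'X_[v s.2.2] :> {mpoly k[n]}].

Definition linsyz_col (s : ('I_n * 'I_q) * ('I_n * 'I_q)) :
  'cV[{mpoly k[n]}]_q :=
  'X_(s.1.1) *: delta_mx s.1.2 0 - 'X_(s.2.1) *: delta_mx s.2.2 0.

Definition linsyz_matrix : 'M[{mpoly k[n]}]_(q, #|linsyz_index|) :=
  \matrix_(a, c) linsyz_col (enum_val c) a 0.

End Monomials.

Definition rank_rat (m p : nat) (A : 'M[int]_(m, p)) : nat :=
  \rank (map_mx intr A : 'M[rat]_(m, p)).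

Definition rank_frac (R : idomainType) (m p : nat) (A : 'M[R]_(m, p)) : nat :=
  \rank (map_mx (@tofrac R) A).

(* Main.v *)
Require Import Defs.
From mathcomp Require Import all_boot all_order all_algebra.
From mathcomp Require Import mpoly.

Set Implicit Arguments.
Unset Strict Implicit.
Unset Printing Implicit Defensive.

Import GRing.Theory.
Local Open Scope ring_scope.

(* Call j, l adjacent when x_i x^(v_j) = x_k x^(v_l) for some i, k, and then
   call the variables i, k adjacent as well.
   For a union C of components of the graph on the v_j, the row vector with
   entry x^(v_j) for j in C and 0 elsewhere kills the linear syzygies; as these
   have rank q - 1, that graph is connected.  If S is a union of components of
   the graph on the variables, the partial degree along S does not change along
   an edge of the first graph, hence is constant on F; were S proper and
   nonempty, a combination of the partial degree and the total degree would
   be a nonzero functional vanishing on the columns of A, against rank A = n.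
   So the variables are connected too; since x_i / x_k = x^(v_l) / x^(v_j) along
   an edge, all ratios x_i / x_k lie in Frac k[F], and these together with a
   single member of F produce every monomial of degree d. *)

Section FractionsOfSubalgebra.

Variables (k : fieldType) (n : nat) (S : {mpoly k[n]} -> Prop).

Local Notation D := (subalg_gen S).

Lemma in_frac_tofrac a : D a -> in_frac D (tofrac a).
Proof.
move=> Da; exists a, 1; split; rewrite ?oner_eq0 ?tofrac1 ?divr1 //.
by rewrite -[1]scale1r; apply: subalg_gen_scalar.
Qed.

Lemma in_frac1 : in_frac D 1.
Proof.
rewrite -tofrac1; apply: in_frac_tofrac.
by rewrite -[1]scale1r; apply: subalg_gen_scalar.
Qed.

Lemma in_fracM f g : in_frac D f -> in_frac D g -> in_frac D (f * g).
Proof.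
move=> [a [b [Da Db b0 ->]]] [c [e [Dc De e0 ->]]].
exists (a * c), (b * e); split; try exact: subalg_gen_mul.
  by rewrite mulf_neq0.
by rewrite !tofracM mulf_div.
Qed.

Lemma in_fracV f : in_frac D f -> in_frac D f^-1.
Proof.
move=> [a [b [Da Db b0 ->]]]; have [->|a0] := eqVneq a 0.
  (* The inverse of 0 is 0 by convention, so here only 0 has to be a fraction. *)
  rewrite tofrac0 mul0r invr0 -tofrac0; apply: in_frac_tofrac.
  by rewrite -[0](scale0r 1); apply: subalg_gen_scalar.
by exists b, a; rewrite invf_div.
Qed.

Lemma in_fracD f g : in_frac D f -> in_frac D g -> in_frac D (f + g).
Proof.
move=> [a [b [Da Db b0 ->]]] [c [e [Dc De e0 ->]]].
exists (a * e + c * b), (b * e); split; try exact: subalg_gen_mul.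
- by apply: subalg_gen_add; apply: subalg_gen_mul.
- by rewrite mulf_neq0.
by rewrite tofracD !tofracM addf_div // tofrac_eq0.
Qed.

End FractionsOfSubalgebra.

Lemma subalg_gen_sub (k : fieldType) (n : nat) (S T : {mpoly k[n]} -> Prop) x :
  (forall y, S y -> T y) -> subalg_gen S x -> subalg_gen T x.
Proof.
move=> sST; elim=> [c|y /sST|y z _ Ty _ Tz|y z _ Ty _ Tz].
- exact: subalg_gen_scalar.
- exact: subalg_gen_mem.
- exact: subalg_gen_add.
- exact: subalg_gen_mul.
Qed.

(** Fractions over [subalg_gen S] contain the scalars and are closed under sums, products and
    inverses, so it suffices to test the generators [T]. *)
Lemma birational_gen (k : fieldType) (n : nat) (S T : {mpoly k[n]} -> Prop) :
  (forall y, S y -> T y) ->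
  (forall y, T y -> in_frac (subalg_gen S) (tofrac y)) ->
  birational (subalg_gen S) (subalg_gen T).
Proof.
move=> sST fT.
have fD y : subalg_gen T y -> in_frac (subalg_gen S) (tofrac y).
  elim=> {y} [c|y /fT //|y z _ fy _ fz|y z _ fy _ fz].
  - by apply/in_frac_tofrac/subalg_gen_scalar.
  - by rewrite tofracD; apply: in_fracD.
  - by rewrite tofracM; apply: in_fracM.
split=> [x|f]; first exact: subalg_gen_sub.
split=> -[a [b [Da Db b0 ->]]].
  by exists a, b; split=> //; apply: (subalg_gen_sub sST).
by apply: in_fracM; [apply: fD | apply/in_fracV/fD].
Qed.

Section LinearSyzygies.

Variables (k : fieldType) (n q : nat) (v : 'I_q -> 'X_{1..n}).

Definition adjacent (i : 'I_n) (j : 'I_q) (i' : 'I_n) (l : 'I_q) : Prop :=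
  (U_(i) + v j = U_(i') + v l)%MM.

Lemma mpolyX_inj : injective (fun m : 'X_{1..n} => 'X_[m] : {mpoly k[n]}).
Proof.
move=> m1 m2 /(congr1 (mcoeff m2)); rewrite !mcoeffX eqxx.
by case: (m1 =P m2) => // _ /eqP; rewrite eq_sym oner_eq0.
Qed.

Lemma mpolyX_neq0 (m : 'X_{1..n}) : 'X_[m] != 0 :> {mpoly k[n]}.
Proof.
apply/eqP=> /(congr1 (mcoeff m)); rewrite mcoeffX mcoeff0 eqxx => /eqP.
by rewrite oner_eq0.
Qed.

Lemma linsyz_adjacent (s : ('I_n * 'I_q) * ('I_n * 'I_q)) :
  s \in linsyz_index k v -> adjacent s.1.1 s.1.2 s.2.1 s.2.2.
Proof. by rewrite inE -!mpolyXD => /eqP /mpolyX_inj. Qed.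

(** Each column comes from one adjacency, whose two indices lie both in [C], where the two terms
    cancel, or both outside, where the row is 0. *)
Lemma row_linsyz_eq0 (C : pred 'I_q) :
  (forall i j i' l, adjacent i j i' l -> C j = C l) ->
  (\row_j (if C j then 'X_[v j] else 0)) *m linsyz_matrix k v = 0.
Proof.
move=> Cadj; set w := \row_j _; apply/rowP=> c; rewrite mxE.
have adj := linsyz_adjacent (enum_valP c).
set s := enum_val c in adj *.
have -> : \sum_j w 0 j * linsyz_matrix k v j c = (w *m linsyz_col k s) 0 0.
  by rewrite mxE; apply: eq_bigr => j _; rewrite [linsyz_matrix _ _ _ _]mxE.
rewrite /linsyz_col mulmxBr -!scalemxAr -!colE !mxE (Cadj _ _ _ _ adj).
by case: ifP; rewrite ?mulr0 ?subr0 // -!mpolyXD adj subrr.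
Qed.

(** If [C] separated two indices, the rows supported on [C] and on its complement would be
    independent in the left kernel, leaving rank at most [q - 2]. *)
Lemma linsyz_connected (C : pred 'I_q) :
  (rank_frac (linsyz_matrix k v)).+1 = q ->
  (forall i j i' l, adjacent i j i' l -> C j = C l) ->
  forall j l, C j = C l.
Proof.
move=> rkL Cadj.
suff CN j l : C j -> C l by move=> j l; apply/idP/idP; apply: CN.
move=> Cj; case Cl: (C l) => //; exfalso.
pose u (P : pred 'I_q) : 'rV[{mpoly k[n]}]_q :=
  \row_a (if P a then 'X_[v a] else 0).
pose W := map_mx (@tofrac {mpoly k[n]}) (col_mx (u C) (u (predC C))).
have W0 : W *m map_mx (@tofrac _) (linsyz_matrix k v) = 0.
  rewrite -map_mxM mul_col_mx !row_linsyz_eq0 ?col_mx0 ?map_mx0 //.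
  by move=> a b a' b' /Cadj /= ->.
have /eqP rkW : row_free W.
  (* A right inverse of [W]: its columns select the entries at [j] (in [C]) and at [l] (outside
     [C]), rescaled to 1. *)
  apply/row_freeP; exists (\matrix_(a, r)
    (if a == (if split r is inl _ then j else l)
     then (tofrac ('X_[v a] : {mpoly k[n]}))^-1 else 0)).
  apply/matrixP=> r s; rewrite !mxE.
  set t := (if split s is inl _ then j else l).
  rewrite (bigD1 t) //= big1 ?addr0 => [|a /negbTE ne_at]; last first.
    by rewrite !mxE ne_at mulr0.
  have X0 a : tofrac ('X_[v a] : {mpoly k[n]}) != 0.
    by rewrite tofrac_eq0 mpolyX_neq0.
  rewrite !mxE eqxx /t.
  by case: (split_ordP r) => r' ->; case: (split_ordP s) => s' ->;
    rewrite ?mxE /= ?Cj ?Cl /= ?tofrac0 ?mul0r ?mulfV // !ord1 -?val_eqE.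
by have := mulmx0_rank_max W0; rewrite rkW -[leqRHS]rkL ltnn.
Qed.

Lemma variables_connected (d : nat) (S : pred 'I_n) :
  (0 < d)%N -> (forall j, mdeg (v j) = d) ->
  rank_rat (log_matrix v) = n ->
  (rank_frac (linsyz_matrix k v)).+1 = q ->
  (forall i j i' l, adjacent i j i' l -> S i = S i') ->
  forall i i', S i = S i'.
Proof.
move=> d_gt0 v_deg rkA rkL Sadj.
suff SN i i' : S i -> S i' by move=> i i'; apply/idP/idP; apply: SN.
move=> Si; case Si': (S i') => //; exfalso.
pose deg (m : 'X_{1..n}) := (\sum_(a | S a) m a)%N.
have degU a : deg U_(a)%MM = S a.
  rewrite /deg big_mkcond (bigD1 a) //= mnm1E eqxx big1 ?addn0.
    by case: (S a).
  by move=> b /negbTE ba; rewrite mnm1E eq_sym ba if_same.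
have degD m1 m2 : deg (m1 + m2)%MM = (deg m1 + deg m2)%N.
  by rewrite -big_split; apply: eq_bigr => a _; rewrite mnmDE.
have j0 : 'I_q by rewrite -rkL; apply: ord0.
(* The two variables of an adjacency contribute equally to [deg], so its level set through [v j0] is
   closed under adjacency. *)
have degE j : deg (v j) = deg (v j0).
  pose C l := deg (v l) == deg (v j0).
  apply/eqP; rewrite -/(C j) (linsyz_connected (C := C) rkL _ j j0) /C //.
  move=> a b a' b' adj; have := congr1 deg adj.
  by rewrite !degD !degU (Sadj _ _ _ _ adj) => /addnI ->.
(* Pairing [f] with [v j] gives [d * deg (v j) - deg (v j0) * d], which is 0. *)
pose f : 'rV[rat]_n := \row_a ((S a * d)%N%:R - (deg (v j0))%:R).
have f0 : f = 0.
  have Afree : row_free (map_mx intr (log_matrix v) : 'M[rat]_(n, q)).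
    by apply/eqP.
  apply/eqP; rewrite -(mulmx_free_eq0 _ Afree); apply/eqP/rowP=> j.
  rewrite !mxE.
  under eq_bigr => a _ do rewrite !mxE mulrBl -pmulrn -!natrM.
  rewrite sumrB -!natr_sum -big_distrr /= -mdegE v_deg -(degE j).
  suff -> : (\sum_a S a * d * v j a = deg (v j) * d)%N by rewrite subrr.
  rewrite /deg big_distrl [RHS]big_mkcond /=; apply: eq_bigr => a _.
  by case: (S a); rewrite ?mul1n ?mul0n // mulnC.
(* The entries of [f] at [i] and [i'] differ by [d]. *)
have := congr1 (fun w : 'rV_n => w 0 i - w 0 i') f0.
rewrite !mxE Si Si' mul1n mul0n !opprB addrA subrK !subr0 => /eqP.
by rewrite Num.Theory.pnatr_eq0 -leqn0 leqNgt d_gt0.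
Qed.

End LinearSyzygies.

Theorem theorem3p7 (k : fieldType) (n q d : nat) (v : 'I_q -> 'X_{1..n})
  (d_ge2 : (2 <= d)%N)
  (v_inj : injective v)
  (v_deg : forall j : 'I_q, mdeg (v j) = d)
  (no_common_factor : forall g : {mpoly k[n]},
     (forall j : 'I_q, divides g 'X_[v j]) -> g \is a GRing.unit)
  (every_var : forall i : 'I_n,
     exists j : 'I_q, divides ('X_i : {mpoly k[n]}) 'X_[v j])
  (rank_log : rank_rat (log_matrix v) = n)
  (rank_linsyz : (rank_frac (linsyz_matrix k v)).+1 = q) :
  birational (subalg_gen (@monomials k n q v))
             (subalg_gen (@monomials_of_degree k n d)).
Proof.
apply: birational_gen => [_ [j ->]|_ [w [w_deg ->]]]; first by exists (v j).
set D := subalg_gen _.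
pose X m : {fraction _} := tofrac ('X_[m] : {mpoly k[n]}).
have X0 m : X m != 0 by rewrite tofrac_eq0 mpolyX_neq0.
have XD m1 m2 : X (m1 + m2)%MM = X m1 * X m2 by rewrite /X mpolyXD tofracM.
have XF j : in_frac D (X (v j)).
  by apply/in_frac_tofrac/subalg_gen_mem; exists j.
pose e := [rel i i' | [exists j, [exists l, U_(i) + v j == U_(i') + v l]%MM]].
have ratio_e i i' : e i i' -> in_frac D (X U_(i')%MM / X U_(i)%MM).
  move=> /existsP[j /existsP[l /eqP /(congr1 X)]]; rewrite !XD => eX.
  suff -> : X U_(i')%MM / X U_(i)%MM = X (v j) / X (v l).
    exact/in_fracM/in_fracV.
  by apply/eqP; rewrite eqr_div // -eX mulrC.
have e_conn i i' : connect e i i'.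
  have d_gt0 : (0 < d)%N by apply: leq_trans d_ge2.
  (* The set [S] is taken to be all variables reachable from [i]. *)
  rewrite -(variables_connected d_gt0 v_deg rank_log rank_linsyz _ i) //.
  have e_sym : connect_sym e.
    apply: sym_connect_sym => a b /=.
    by apply/existsP/existsP=> -[j /existsP[l /eqP E]];
      exists l; apply/existsP; exists j; rewrite E.
  move=> a j b l adj; apply/(same_connect_r e_sym)/connect1 => /=.
  by apply/existsP; exists j; apply/existsP; exists l; apply/eqP.
have ratio i i' : in_frac D (X U_(i')%MM / X U_(i)%MM).
  (* The ratios along a path telescope. *)
  have /connectP[p] := e_conn i i'; elim: p i => [|a p IH] i /=.
    by move=> _ ->; rewrite divff //; apply: in_frac1.
  move=> /andP[/ratio_e ra /IH{}IH /IH].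
  by move/in_fracM/(_ ra); rewrite mulrA divfK.
have ratio_deg i m : in_frac D (X m / X U_(i)%MM ^+ mdeg m).
  rewrite mdegE -prodrXr /X mpolyXE_id rmorph_prod -prodf_div.
  elim/big_ind: _ => [|f g|a _]; [exact: in_frac1 | exact: in_fracM |].
  rewrite rmorphXn -expr_div_n.
  elim: (m a) => [|t IH]; first by rewrite expr0; apply: in_frac1.
  by rewrite exprS; apply: in_fracM (ratio i a) IH.
have j0 : 'I_q by rewrite -rank_linsyz; apply: ord0.
(* Without variables every monomial would have degree 0, against [2 <= d]. *)
have [i0 _|noI] := pickP (@predT 'I_n); last first.
  have := v_deg j0; rewrite mdegE big1 => [d0|i _]; last by have := noI i.
  by rewrite -d0 in d_ge2.
(* With [x] the variable [i0]: [X w = (X w / x^d) * (X (v j0) / x^d)^-1 * X (v j0)]. *)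
have := in_fracV (ratio_deg i0 (v j0)).
move/(in_fracM (ratio_deg i0 w))/in_fracM/(_ (XF j0)).
by rewrite w_deg v_deg invf_div mulrA divfK // divfK ?expf_neq0.
Qed.
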